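(* Let $p=2$, let $L$, $\mathbf L$, $W_{\mathrm G}$, $\mathrm G$, $\mathbf W_{\mathrm D}$, $\mathrm D$, $V$ be as in the context, let $f\in L'$, $\mathbf F\in\mathbf L'$, and let $\mathbf a:\mathbf L\to\mathbf L'$ and $a:L\to L'$ satisfy assumptions (H1)–(H4) of the context with constants $\overline\alpha$ and $\underline\alpha>0$. Let $\bar u\in W_{\mathrm G}$ be the (unique) solution of $$\forall v\in W_{\mathrm G},\quad\langle\mathbf a(\mathrm G\bar u),\mathrm Gv\rangle_{\mathbf L',\mathbf L}+\langle a(\bar u),v\rangle_{L',L}=\langle f,v\rangle_{L',L}-\langle\mathbf F,\mathrm Gv\rangle_{\mathbf L',\mathbf L}$$ (so that $\mathbf a(\mathrm G\bar u)+\mathbf F\in\mathbf W_{\mathrm D}$). Let $\mathcal D$ be a gradient discretisation. Then there exists one and only one $u_{\mathcal D}\in X_{\mathcal D}$ such that $$\forall v\in X_{\mathcal D},\quad\langle\mathbf a(G_{\mathcal D}u_{\mathcal D}),G_{\mathcal D}v\rangle_{\mathbf L',\mathbf L}+\langle a(P_{\mathcal D}u_{\mathcal D}),P_{\mathcal D}v\rangle_{L',L}=\langle f,P_{\mathcal D}v\rangle_{L',L}-\langle\mathbf F,G_{\mathcal D}v\rangle_{\mathbf L',\mathbf L}.$$ This solution satisfies $$\|\mathrm G\bar u-G_{\mathcal D}u_{\mathcal D}\|_{\mathbf L}\le\frac1{\underline\alpha}\left[W_{\mathcal D}(\mathbf a(\mathrm G\bar u)+\mathbf F)+(\overline\alpha(1+C_{\mathcal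 D})+\underline\alpha)S_{\mathcal D}(\bar u)\right],$$ $$\|\bar u-P_{\mathcal D}u_{\mathcal D}\|_{L}\le\frac1{\underline\alpha}\left[C_{\mathcal D}W_{\mathcal D}(\mathbf a(\mathrm G\bar u)+\mathbf F)+(C_{\mathcal D}(1+C_{\mathcal D})\overline\alpha+\underline\alpha)S_{\mathcal D}(\bar u)\right].$$ Moreover, the reverse inequalities $$W_{\mathcal D}(\mathbf a(\mathrm G\bar u)+\mathbf F)\le\overline\alpha\,\|\mathrm G\bar u-G_{\mathcal D}u_{\mathcal D}\|_{\mathbf L},$$ $$S_{\mathcal D}(\bar u)\le\|\bar u-P_{\mathcal D}u_{\mathcal D}\|_L+\|\mathrm G\bar u-G_{\mathcal D}u_{\mathcal D}\|_{\mathbf L}$$ also hold, which shows the existence of $C_1>0$ and $C_2>0$, depending only on $\overline\alpha$ and $\underline\alpha$, such that $$\frac{C_1}{1+C_{\mathcal D}}\left[S_{\mathcal D}(\bar u)+W_{\mathcal D}(\mathbf a(\mathrm G\bar u)+\mathbf F)\right]\le\|\bar u-P_{\mathcal D}u_{\mathcal D}\|_L+\|\mathrm G\bar u-G_{\mathcal D}u_{\mathcal D}\|_{\mathbf L}\le C_2(1+C_{\mathcal D})^2\left[S_{\mathcal D}(\bar u)+W_{\mathcal D}(\mathbf a(\mathrm G\bar u)+\mathbf F)\right].$$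
   Context: All vector spaces are real; here $p=2$. Let $L$ and $\mathbf L$ be separable reflexive Banach spaces with topological duals $L'$ and $\mathbf L'$. Let $W_{\mathrm G}\subset L$ be a dense linear subspace of $L$ and let $\mathrm G:W_{\mathrm G}\to\mathbf L$ be a linear operator whose graph is closed in $L\times\mathbf L$. Put $\|u\|_{W_{\mathrm G},\mathcal G}=(\|u\|_L^2+\|\mathrm Gu\|_{\mathbf L}^2)^{1/2}$ for $u\in W_{\mathrm G}$. Define $\mathbf W_{\mathrm D}=\{\mathbf v\in\mathbf L' : \exists w\in L',\ \forall u\in W_{\mathrm G},\ \langle\mathbf v,\mathrm Gu\rangle_{\mathbf L',\mathbf L}+\langle w,u\rangle_{L',L}=0\}$; for $\mathbf v\in\mathbf W_{\mathrm D}$ the element $w$ is unique and one sets $\mathrm D\mathbf v:=w$. Let $V$ be a closed subspace of $L'$. For $u\in L$ put $|u|_{L,V}=\sup_{\mu\in V\setminus\{0\}}\frac{|\langle\mu,u\rangle_{L',L}|}{\|\mu\|_{L'}}$ if $V\neq\{0\}$ and $|u|_{L,V}=0$ if $V=\{0\}$. For $u\in W_{\mathrm G}$ put $\|u\|_{W_{\mathrm G}}=(|u|_{L,V}^2+\|\mathrm Gu\|_{\mathbf L}^2)^{1/2}$. Standing assumption: there is $C_{W_{\mathrm G},V}>0$ with $\|u\|_{W_{\mathrm G},\mathcal G}\le C_{W_{\mathrm G},V}\|u\|_{W_{\mathrm G}}$ for all $u\in W_{\mathrm G}$. Assumptions: (H1) $\mathbf a:\mathbf L\to\mathbf L'$ is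 linear continuous with norm bounded by $\overline\alpha$. (H2) There is $\underline\alpha>0$ with $\underline\alpha\|\mathbf v\|_{\mathbf L}^2\le\langle\mathbf a(\mathbf v),\mathbf v\rangle_{\mathbf L',\mathbf L}$ for all $\mathbf v\in\mathbf L$. (H3) $a:L\to L'$ is linear continuous with norm bounded by $\overline\alpha$. (H4) $\underline\alpha|v|_{L,V}^2\le\langle a(v),v\rangle_{L',L}$ for all $v\in L$. A gradient discretisation is a triple $\mathcal D=(X_{\mathcal D},P_{\mathcal D},G_{\mathcal D})$ where $X_{\mathcal D}$ is a finite dimensional real vector space, $P_{\mathcal D}:X_{\mathcal D}\to L$ and $G_{\mathcal D}:X_{\mathcal D}\to\mathbf L$ are linear, and $\|v\|_{\mathcal D}:=(|P_{\mathcal D}v|_{L,V}^2+\|G_{\mathcal D}v\|_{\mathbf L}^2)^{1/2}$ is a norm on $X_{\mathcal D}$. Put $$C_{\mathcal D}=\max_{v\in X_{\mathcal D}\setminus\{0\}}\frac{\|P_{\mathcal D}v\|_L}{\|v\|_{\mathcal D}},\qquad S_{\mathcal D}(\varphi)=\min_{v\in X_{\mathcal D}}\left(\|P_{\mathcal D}v-\varphi\|_L+\|G_{\mathcal D}v-\mathrm G\varphi\|_{\mathbf L}\right)\ (\varphi\in W_{\mathrm G}),$$ $$W_{\mathcal D}(\boldsymbol\varphi)=\sup_{u\in X_{\mathcal D}\setminus\{0\}}\frac{|\langle\boldsymbol\varphi,G_{\mathcal D}u\rangle_{\mathbf L',\mathbf L}+\langle\mathrm D\boldsymbol\varphi,P_{\mathcal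 D}u\rangle_{L',L}|}{\|u\|_{\mathcal D}}\ (\boldsymbol\varphi\in\mathbf W_{\mathrm D}).$$
   Formalization: The first reverse inequality is false as printed (L=**L**=R, G=0, a=**a**=id, f=F=1, P_D=G_D=id); it is replaced by W_D ≤ ᾱ(‖Gū−G_D u_D‖ + C_D‖ū−P_D u_D‖), and the printed form is kept only when a=0. *)

(* Defs.v *)
From HB Require Import structures.
From mathcomp Require Import all_boot all_order all_algebra.
From mathcomp Require Import all_classical all_reals all_analysis.

Set Implicit Arguments.
Unset Strict Implicit.
Unset Printing Implicit Defensive.

Import Order.TTheory GRing.Theory Num.Theory.
Import numFieldNormedType.Exports.

Local Open Scope classical_set_scope.
Local Open Scope ring_scope.

(* [sup] is 0 on the empty set, hence so is the operator norm on a trivial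
   space.  It is also 0 on unbounded sets: [opnorm f] is the operator norm only
   for [f] linear and continuous. *)
Definition opnorm (R : realType) (E F : normedModType R) (f : E -> F) : R :=
  sup [set `|f x| / `|x| | x in [set x | x != 0]].

Section opnorm_theory.
Context (R : realType) (E F : normedModType R).
Implicit Types f : {linear E -> F}.

Lemma opnorm_has_ubound f : continuous f ->
  has_ubound [set `|f x| / `|x| | x in [set x : E | x != 0]].
Proof.
move=> fc; have /linear_boundedP/pinfty_ex_gt0[M M0 fM] :=
  @continuous_linear_bounded _ _ _ 0 f (fc 0).
by exists M => _ [x /= x0 <-]; rewrite ler_pdivrMr ?normr_gt0.
Qed.

Lemma opnorm_ge0 (f : E -> F) : 0 <= opnorm f.
Proof.
rewrite /opnorm; set A := [set _ | _ in _].
have [supA|/sup_out->//] := pselect (has_sup A).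
have [[_ [x xP _]] _] := supA.
apply: (@le_trans _ _ (`|f x| / `|x|)); first by rewrite divr_ge0.
by apply: sup_upper_bound => //; exists x.
Qed.

Lemma ler_opnorm f x : continuous f -> `|f x| <= opnorm f * `|x|.
Proof.
move=> fc; have [->|x0] := eqVneq x 0; first by rewrite linear0 !normr0 mulr0.
rewrite -ler_pdivrMr ?normr_gt0//; apply: sup_upper_bound; last by exists x.
by split; [exists (`|f x| / `|x|), x | exact: opnorm_has_ubound].
Qed.

Lemma opnorm_le (f : E -> F) M : 0 <= M -> (forall x, `|f x| <= M * `|x|) ->
  opnorm f <= M.
Proof.
move=> M0 fM; rewrite /opnorm.
set A := [set _ | _ in _].
have [->|/set0P ne] := eqVneq A set0; first by rewrite sup0.
apply: ge_sup => // _ [x /= x0 <-].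
by rewrite ler_pdivrMr ?normr_gt0.
Qed.

End opnorm_theory.

Section dual_def.
Context (R : realType) (E : normedModType R).

Definition dual_pred : {pred (E -> R^o)} :=
  [pred f | `[< linear f /\ continuous f >]].

Record dual := Dual { dual_val :> E -> R^o; _ : dual_val \in dual_pred }.

HB.instance Definition _ := [isSub for dual_val].
HB.instance Definition _ := [Choice of dual by <:].

Lemma dual_linear (f : dual) : linear f.
Proof. by case: f => f /= /[!inE] -[]. Qed.

Lemma dual_continuous (f : dual) : continuous f.
Proof. by case: f => f /= /[!inE] -[]. Qed.

HB.instance Definition _ (f : dual) :=
  GRing.isLinear.Build R E R^o _ (dual_val f) (dual_linear f).

Fact dual_submod_closed : submod_closed dual_pred.
Proof.
split.
  rewrite inE; split; last by move=> x; exact: cvg_cst.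
  by move=> c x y; rewrite -[LHS]/(0 : R) -[RHS]/(c * 0 + 0 : R) mulr0 addr0.
move=> c f g /[!inE] -[lf cf] [lg cg]; split; last first.
  by move=> x; apply: cvgD; [apply: cvgZr; exact: cf | exact: cg].
move=> k x y; rewrite -[LHS]/(c *: f (k *: x + y) + g (k *: x + y)).
rewrite -[RHS]/(k *: (c *: f x + g x) + (c *: f y + g y)) lf lg.
by rewrite !scalerDr !scalerA (mulrC c k) addrACA.
Qed.

HB.instance Definition _ :=
  GRing.isSubmodClosed.Build R (E -> R^o) dual_pred dual_submod_closed.
HB.instance Definition _ := [SubChoice_isSubLmodule of dual by <:].

Lemma dualDE (f g : dual) x : (f + g) x = f x + g x. Proof. by []. Qed.
Lemma dualZE c (f : dual) x : (c *: f) x = c *: f x. Proof. by []. Qed.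
Lemma dual0E x : (0 : dual) x = 0. Proof. by []. Qed.

Lemma ler_dual (f : dual) x : `|f x| <= opnorm f * `|x|.
Proof. exact/ler_opnorm/dual_continuous. Qed.

Let dual_normD (f g : dual) : opnorm (f + g) <= opnorm f + opnorm g.
Proof.
apply: opnorm_le => [|x]; first by rewrite addr_ge0 ?opnorm_ge0.
by rewrite dualDE mulrDl (le_trans (ler_normD _ _))// lerD ?ler_dual.
Qed.

Let dual_normZ_le c (f : dual) : opnorm (c *: f) <= `|c| * opnorm f.
Proof.
apply: opnorm_le => [|x]; first by rewrite mulr_ge0 ?opnorm_ge0.
by rewrite dualZE normrZ -mulrA ler_wpM2l ?ler_dual.
Qed.

Let dual_normZ c (f : dual) : opnorm (c *: f) = `|c| * opnorm f.
Proof.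
apply/eqP; rewrite eq_le dual_normZ_le /=.
have [->|c0] := eqVneq c 0; first by rewrite normr0 mul0r opnorm_ge0.
rewrite -ler_pdivlMl ?normr_gt0// -normfV.
by have := dual_normZ_le c^-1 (c *: f); rewrite scalerA mulVf// scale1r.
Qed.

Let dual_norm_eq0 (f : dual) : opnorm f = 0 -> f = 0.
Proof.
move=> f0; apply/val_inj/funext => x /=; apply/eqP.
by rewrite -normr_le0 (le_trans (ler_dual f x))// f0 mul0r.
Qed.

HB.instance Definition _ := Lmodule_isNormed.Build R dual
  dual_normD dual_normZ dual_norm_eq0.

Lemma dual_normE (f : dual) : `|f| = opnorm f. Proof. by []. Qed.

End dual_def.

Section spaces.
Context (R : realType).

Definition separable_space (T : topologicalType) :=
  exists A : set T, countable A /\ dense A.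

(* Surjectivity of the canonical embedding of E into its bidual. *)
Definition reflexive_space (E : normedModType R) :=
  forall Phi : dual (dual E), exists x : E, forall mu : dual E, Phi mu = mu x.

(* Nonnegativity follows from these three properties. *)
Definition is_norm (X : lmodType R) (N : X -> R) :=
  [/\ forall x y, N (x + y) <= N x + N y,
      forall c x, N (c *: x) = `|c| * N x
    & forall x, N x = 0 -> x = 0].

(* |u|_{L,V}; equal to 0 for V = {0}, as the supremum is then over the empty
   set. *)
Definition dual_seminorm (L : normedModType R) (V : set (dual L)) (u : L) : R :=
  sup [set `|mu u| / `|mu| | mu in V `&` [set mu | mu != 0]].

End spaces.

(* The operator D adjoint to G, where only the values of G on WG matter. *)
Section adjoint.
Context (R : realType) (L LL : normedModType R) (WG : set L) (G : L -> LL).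

Definition is_adjoint (v : dual LL) (w : dual L) :=
  forall u, WG u -> v (G u) + w u = 0.

Definition dom_adjoint : set (dual LL) :=
  [set v | exists w : dual L, is_adjoint v w].

(* By [is_adjoint_unique], the choice is forced on [dom_adjoint] when WG is
   dense; the value outside of [dom_adjoint] is irrelevant. *)
Definition adjoint (v : dual LL) : dual L := xget 0 [set w | is_adjoint v w].

Lemma adjointP v : dom_adjoint v -> is_adjoint v (adjoint v).
Proof. by move=> [w vw]; rewrite /adjoint; case: xgetP => [_ -> //|/(_ w)]. Qed.

Lemma is_adjoint_unique v w1 w2 : dense WG ->
  is_adjoint v w1 -> is_adjoint v w2 -> w1 = w2.
Proof.
move=> WGd vw1 vw2; apply/eqP; rewrite -subr_eq0; apply/eqP.
set w := w1 - w2; apply/val_inj/funext => x /=; apply/eqP/negPn/negP => wx0.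
have [y [/= wy0 WGy]] : [set y | w y != 0] `&` WG !=set0.
  apply: WGd; first by exists x.
  rewrite (_ : [set y | _] = w @^-1` (~` [set 0])); last first.
    by apply/seteqP; split => y /= /eqP.
  apply: open_comp; first by move=> y _; exact: dual_continuous.
  exact/closed_openC/closed_eq.
move/eqP: wy0; apply; apply/eqP; rewrite subr_eq0; apply/eqP.
by apply: (addrI (v (G y))); rewrite vw1// vw2.
Qed.

End adjoint.

Section gradient_discretisation.
Context (R : realType) (L LL : normedModType R) (V : set (dual L)).

Record gradient_discretisation := GradientDiscretisation {
  gd_space :> vectType R ;
  gd_P : {linear gd_space -> L} ;
  gd_G : {linear gd_space -> LL} ;
  gd_is_norm : is_norm (fun v : gd_space =>
    Num.sqrt (dual_seminorm V (gd_P v) ^+ 2 + `|gd_G v| ^+ 2)) }.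

Context (D : gradient_discretisation).

Definition gd_norm (v : D) : R :=
  Num.sqrt (dual_seminorm V (gd_P D v) ^+ 2 + `|gd_G D v| ^+ 2).

(* As D is finite dimensional, the sets below are bounded and the suprema and
   the infimum are attained; on the trivial space, [gd_C] and [gd_W] are 0. *)
Definition gd_C : R :=
  sup [set `|gd_P D v| / gd_norm v | v in [set v : D | v != 0]].

Definition gd_S (G : L -> LL) (phi : L) : R :=
  inf (range (fun v : D => `|gd_P D v - phi| + `|gd_G D v - G phi|)).

Definition gd_W (WG : set L) (G : L -> LL) (phi : dual LL) : R :=
  sup [set `|phi (gd_G D u) + adjoint WG G phi (gd_P D u)| / gd_norm u
       | u in [set u : D | u != 0]].

End gradient_discretisation.

Arguments gradient_discretisation {R L} LL V.

(* Main.v *)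
Require Import Defs.
From HB Require Import structures.
From mathcomp Require Import all_boot all_order all_algebra.
From mathcomp Require Import all_classical all_reals all_analysis.
From mathcomp Require Import ring lra.

Set Implicit Arguments.
Unset Strict Implicit.
Unset Printing Implicit Defensive.

Import Order.TTheory GRing.Theory Num.Theory.
Import numFieldNormedType.Exports.
Import VectorInternalTheory.

Local Open Scope classical_set_scope.
Local Open Scope ring_scope.

(** The argument is a Strang-type estimate for a nonconforming approximation.
Write [B(u, v) = aa (G_D u) (G_D v) + a (P_D u) (P_D v)] for the discrete form
and [N] for the discrete norm.  The two coercivity hypotheses add up to
[alpha_lo N(u)^2 <= B(u, u)], so [B] is nondegenerate; on a finite dimensional
space this gives existence and uniqueness of the discrete solution
([nondegenerate_form_solvable], [gd_scheme_well_posed]).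

The continuous equation says that [aa (G ub) + F] lies in the domain of the
adjoint [D] of [G], with [D (aa (G ub) + F) = a ub - f].  Subtracting the
discrete equation, the residual measured by [W_D] is therefore exactly the
form applied to the error ([defect_error]):
  [(aa (G ub) + F) (G_D v) + D (aa (G ub) + F) (P_D v)
     = aa (G ub - G_D uD) (G_D v) + a (ub - P_D uD) (P_D v)].
All estimates are readings of this identity.

Bounding the right-hand side by continuity of [aa] and [a], together with
[|G_D v| <= N(v)] and [|P_D v| <= C_D N(v)], bounds [W_D] by the error.
Conversely, for an arbitrary interpolant [v], test with [v - uD] and write
[v - uD] as (interpolant - exact) + (exact - discrete): coercivity yields
[alpha_lo N(v - uD) <= W_D + alpha_up (1 + C_D) S(v)], where [S(v)] is the
interpolation error ([gd_norm_error]); the triangle inequality and the infimum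
over [v] give the two error bounds.

[C_D] and [W_D] are suprema of ratios [p / N] with [p] a seminorm and [N] a norm
on a finite dimensional space.  For such suprema to bound [p], the ratios have
to be bounded, which is the comparison of norms in finite dimension
([seminorm_le_norm]): [N] is continuous in coordinates, hence bounded below by a
positive constant on the compact unit sphere. *)

(** * Norms and seminorms on finite dimensional spaces *)

Section finite_dimensional.
Context (R : realType) (X : vectType R).

Definition is_seminorm (p : X -> R) :=
  (forall x y, p (x + y) <= p x + p y) /\ (forall c x, p (c *: x) = `|c| * p x).

Lemma is_norm_seminorm (N : X -> R) : is_norm N -> is_seminorm N.
Proof. by case. Qed.

Lemma is_seminorm_linear (F : normedModType R) (h : {linear X -> F}) :
  is_seminorm (fun x => `|h x|).
Proof.
by split=> [x y|c x]; [rewrite linearD ler_normD | rewrite linearZ normrZ].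
Qed.

Section seminorm.
Context (p : X -> R) (p_seminorm : is_seminorm p).

Lemma seminorm0 : p 0 = 0.
Proof. by rewrite -(scale0r 0) p_seminorm.2 normr0 mul0r. Qed.

Lemma seminormN x : p (- x) = p x.
Proof. by rewrite -scaleN1r p_seminorm.2 normrN1 mul1r. Qed.

Lemma seminorm_ge0 x : 0 <= p x.
Proof.
have := p_seminorm.1 x (- x); rewrite subrr seminorm0 seminormN => h; lra.
Qed.

Lemma ler_dist_seminorm x y : `|p x - p y| <= p (x - y).
Proof.
have := p_seminorm.1 (x - y) y; have := p_seminorm.1 (y - x) x.
rewrite !subrK -opprB seminormN => hx hy.
by rewrite ler_norml; apply/andP; split; lra.
Qed.

Lemma seminorm_sum I (s : seq I) (g : I -> X) :
  p (\sum_(i <- s) g i) <= \sum_(i <- s) p (g i).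
Proof.
elim: s => [|i s ih]; first by rewrite !big_nil seminorm0.
by rewrite !big_cons (le_trans (p_seminorm.1 _ _))// lerD2l.
Qed.

(** Expanding along the canonical basis, the sum of the values of [p] at the basis
vectors serves as the constant. *)
Lemma seminorm_r2v_bounded :
  exists2 M, 0 <= M & forall c : 'rV[R]_(dim X), p (r2v c) <= M * `|c|.
Proof.
exists (\sum_(i < dim X) p (r2v (delta_mx 0 i))).
  by apply: sumr_ge0 => i _; exact: seminorm_ge0.
move=> c; rewrite {1}(row_sum_delta c) linear_sum.
apply: (le_trans (seminorm_sum _ _)); rewrite mulr_suml; apply: ler_sum => i _.
rewrite linearZ p_seminorm.2 mulrC ler_wpM2l ?seminorm_ge0//.
rewrite /Num.norm/= mx_normrE; apply: le_trans (le_bigmax _ _ (ord0, i)).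
by [].
Qed.

(** By the reverse triangle inequality a seminorm is Lipschitz with the constant
of [seminorm_r2v_bounded]. *)
Lemma continuous_seminorm_r2v :
  continuous (fun c : 'rV[R]_(dim X) => p (r2v c)).
Proof.
have [M M0 pM] := seminorm_r2v_bounded.
move=> c; apply/(@cvgrPdist_le _ _ _ (nbhs c) (nbhs_filter c)) => e e0.
(* M may be 0, so the Lipschitz constant is enlarged to divide by it. *)
have M1 : 0 < M + 1 by lra.
near=> d.
apply: (le_trans (ler_dist_seminorm _ _)).
rewrite -linearB; apply: (le_trans (pM _)).
apply: (@le_trans _ _ ((M + 1) * `|c - d|)).
  by rewrite ler_wpM2r//; lra.
rewrite mulrC -ler_pdivlMr//.
near: d; apply/nbhs_ballP; exists (e / (M + 1)); first exact: divr_gt0.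
by move=> d; rewrite -ball_normE => /ltW.
Unshelve. all: by end_near. Qed.

End seminorm.

(** The constant is the minimum of [N] on the unit sphere of the coordinate
space, attained by compactness and positive because [N] is definite. *)
Lemma norm_r2v_lower_bound (N : X -> R) : is_norm N ->
  exists2 m, 0 < m & forall c : 'rV[R]_(dim X), m * `|c| <= N (r2v c).
Proof.
move=> N_norm; have N_semi := is_norm_seminorm N_norm.
pose S := [set c : 'rV[R]_(dim X) | `|c| = 1].
have Sc : compact S.
  apply: bounded_closed_compact.
    by exists 1; split=> [|x x1 c /= ->]; [rewrite num_real | exact: ltW].
  have -> : S = (fun c => `|c|) @^-1` [set 1] by [].
  by apply: closed_comp => [c _|]; [exact: norm_continuous | exact: closed_eq].
have unitS c : c != 0 -> S (`|c|^-1 *: c).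
  by move=> c0; rewrite /S/= normrZ normfV normr_id mulVf// normr_eq0.
(* The sphere is empty exactly when the space is trivial. *)
have [S0|/set0P S0] := eqVneq S set0.
  exists 1 => // c.
  have [->|c0] := eqVneq c 0.
    by rewrite normr0 mulr0; exact: seminorm_ge0.
  by have := unitS c c0; rewrite S0.
have [c0 c0S c0min] := compact_EVT_min S0 Sc
  (continuous_subspaceT (continuous_seminorm_r2v N_semi)).
exists (N (r2v c0)) => [|c].
  rewrite lt_neqAle seminorm_ge0// andbT eq_sym; apply/eqP => N0.
  case: N_norm => _ _ /(_ _ N0)/(canRL r2vK); rewrite linear0 => c00.
  by move: c0S; rewrite inE /S/= c00 normr0 => /eqP; rewrite eq_sym oner_eq0.
have [->|cn0] := eqVneq c 0.
  by rewrite normr0 mulr0; exact: seminorm_ge0.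
have /c0min : `|c|^-1 *: c \in S by rewrite inE; exact: unitS.
rewrite linearZ N_semi.2 normfV normr_id.
by rewrite ler_pdivlMl ?normr_gt0// mulrC.
Qed.

Lemma seminorm_le_norm (p N : X -> R) : is_seminorm p -> is_norm N ->
  exists2 K, 0 <= K & forall x, p x <= K * N x.
Proof.
move=> /seminorm_r2v_bounded[M M0 pM] /norm_r2v_lower_bound[m m0 mN].
exists (M / m) => [|x]; first by rewrite divr_ge0 // ltW.
rewrite -(v2rK x) (le_trans (pM _))// -mulrA ler_wpM2l//.
by rewrite ler_pdivlMl.
Qed.

(** The common form of the constants [gd_C] and [gd_W], for which [N] is the
discrete norm. *)
Section ratio_sup.
Context (p N : X -> R) (p_seminorm : is_seminorm p) (N_norm : is_norm N).

Definition ratio_sup := sup [set p v / N v | v in [set v | v != 0]].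

Let N_gt0 v : v != 0 -> 0 < N v.
Proof.
move=> v0; rewrite lt_neqAle seminorm_ge0 ?andbT; last exact: is_norm_seminorm.
by apply: contraNneq v0 => /esym; case: N_norm => _ _ /[apply] ->.
Qed.

(** A supremum of reals bounds its set only if the set is bounded above; here the
bound is [seminorm_le_norm]. *)
Lemma ler_ratio_sup v : p v <= ratio_sup * N v.
Proof.
have [->|v0] := eqVneq v 0.
  by rewrite !seminorm0 ?mulr0//; exact: is_norm_seminorm.
rewrite -ler_pdivrMr ?N_gt0//; apply: sup_upper_bound; last by exists v.
split; first by exists (p v / N v), v.
have [K _ pK] := seminorm_le_norm p_seminorm N_norm.
by exists K => _ [w /= w0 <-]; rewrite ler_pdivrMr ?N_gt0.
Qed.

Lemma ratio_sup_le K : 0 <= K -> (forall v, p v <= K * N v) -> ratio_sup <= K.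
Proof.
move=> K0 pK; rewrite /ratio_sup; set A := [set _ | _ in _].
have [->|/set0P ne] := eqVneq A set0; first by rewrite sup0.
by apply: ge_sup => // _ [v /= v0 <-]; rewrite ler_pdivrMr ?N_gt0.
Qed.

Lemma ratio_sup_ge0 : 0 <= ratio_sup.
Proof.
have [[v v0]|Xtriv] := pselect (exists v : X, v != 0).
  rewrite -(pmulr_lge0 _ (N_gt0 v0)).
  exact: le_trans (seminorm_ge0 p_seminorm v) (ler_ratio_sup v).
rewrite /ratio_sup (_ : [set _ | _ in _] = set0) ?sup0//.
by rewrite -subset0 => _ [v /= v0 _]; apply: Xtriv; exists v.
Qed.

End ratio_sup.
End finite_dimensional.

(** * Linear systems given by a nondegenerate bilinear form *)

(** In finite dimension an injective endomorphism is surjective.  The one used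
sends [u] to the vector whose coordinates in a basis [e] are the [b u e_i]; it is
injective because [b] is nondegenerate, and [u] solves the system if and only if
its image is the vector with coordinates [l e_i]. *)
Lemma nondegenerate_form_solvable (K : fieldType) (X : vectType K)
    (b : X -> X -> K) (l : X -> K) :
  (forall u, scalar (b u)) -> (forall v, scalar (b^~ v)) -> scalar l ->
  (forall u, (forall v, b u v = 0) -> u = 0) ->
  exists! u, forall v, b u v = l v.
Proof.
move=> b_linr b_linl l_lin b_nondeg.
pose e := vbasis {:X}.
have coordE g (gl : scalar g) v : g v = \sum_i coord e i v * g e`_i.
  pose gL := HB.pack_for {scalar X} g (GRing.isLinear.Build K X K _ g gl).
  rewrite {1}(coord_vbasis (memvf v)).
  rewrite -[LHS]/(gL _) linear_sum; apply: eq_bigr => i _.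
  by rewrite linearZ.
pose T u := \sum_(i < \dim {:X}) b u e`_i *: e`_i.
have T_lin : linear T.
  move=> c u v; rewrite scaler_sumr -big_split; apply: eq_bigr => i _ /=.
  by rewrite b_linl scalerDl scalerA.
pose TL := linfun (HB.pack_for {linear X -> X} T
  (GRing.isLinear.Build K X X _ T T_lin)).
have e_inj (x y : 'I_(\dim {:X}) -> K) :
    \sum_i x i *: e`_i = \sum_i y i *: e`_i -> forall i, x i = y i.
  move=> xy i.
  by rewrite -(coord_sum_free x i (basis_free (vbasisP _))) xy coord_sum_free //
    (basis_free (vbasisP _)).
have TLE u : TL u = T u by rewrite lfunE.
have ker0 : lker TL == 0%VS.
  rewrite -subv0; apply/subvP => u; rewrite memv_ker TLE memv0 => /eqP Tu0.
  apply/eqP/b_nondeg => v; rewrite (coordE _ (b_linr u)) big1// => i _.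
  rewrite (e_inj (fun i => b u e`_i) (fun=> 0) _ i) ?mulr0//.
  by rewrite -/(T u) Tu0 big1// => j _; rewrite scale0r.
have : \sum_(i < \dim {:X}) l e`_i *: e`_i \in limg TL by rewrite lker0_limgf ?memvf.
move=> /memv_imgP[u _]; rewrite TLE => /esym/e_inj bu.
exists u; split=> [v|u' bu'].
  rewrite (coordE _ (b_linr u)) (coordE _ l_lin); apply: eq_bigr => i _.
  by rewrite bu.
apply/(lker0P ker0); rewrite !TLE /T; apply: eq_bigr => i _.
by rewrite bu bu'.
Qed.

(** * Operators with values in a dual space *)

Section linear_to_dual.
Context (R : realType) (E E' : normedModType R) (A : {linear E -> dual E'}).

Lemma dual_applyP c x y z : A (c *: x + y) z = c * A x z + A y z.
Proof. by rewrite linearP. Qed.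

Lemma dual_applyD x y z : A (x + y) z = A x z + A y z.
Proof. by rewrite linearD. Qed.

Lemma dual_applyB x y z : A (x - y) z = A x z - A y z.
Proof. by rewrite linearB. Qed.

End linear_to_dual.

Lemma ler_continuous_form (R : realType) (E : normedModType R)
    (A : {linear E -> dual E}) (M : R) : continuous A -> opnorm A <= M ->
  forall x y, `|A x y| <= M * `|x| * `|y|.
Proof.
move=> Ac AM x y; apply: (le_trans (ler_dual _ _)); rewrite ler_wpM2r//.
by apply: (le_trans (ler_opnorm x Ac)); rewrite ler_wpM2r.
Qed.

(** * The constants of a gradient discretisation *)

Section discretisation_constants.
Context (R : realType) (L LL : normedModType R) (V : set (dual L)).
Context (D : gradient_discretisation LL V).
Implicit Types v : D.

Lemma gd_norm_is_norm : is_norm (@gd_norm R L LL V D).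
Proof. exact: gd_is_norm. Qed.

Lemma gd_norm_ge0 v : 0 <= gd_norm v.
Proof. exact: sqrtr_ge0. Qed.

Lemma sqr_gd_norm v :
  gd_norm v ^+ 2 = dual_seminorm V (gd_P D v) ^+ 2 + `|gd_G D v| ^+ 2.
Proof. by rewrite sqr_sqrtr// addr_ge0 ?sqr_ge0. Qed.

Lemma ler_gd_G v : `|gd_G D v| <= gd_norm v.
Proof.
rewrite -ler_sqr ?nnegrE ?gd_norm_ge0// sqr_gd_norm.
by rewrite lerDr sqr_ge0.
Qed.

Lemma gd_C_ge0 : 0 <= gd_C D.
Proof. exact: ratio_sup_ge0 (is_seminorm_linear _) gd_norm_is_norm. Qed.

Lemma ler_gd_P v : `|gd_P D v| <= gd_C D * gd_norm v.
Proof. exact: ler_ratio_sup (is_seminorm_linear _) gd_norm_is_norm v. Qed.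

Section consistency.
Context (G : L -> LL) (phi : L).

Lemma gd_S_le v : gd_S D G phi <= `|gd_P D v - phi| + `|gd_G D v - G phi|.
Proof.
apply: ge_inf; last by exists v.
by exists 0 => _ [w _ <-]; rewrite addr_ge0.
Qed.

Lemma le_gd_S c :
  (forall v, c <= `|gd_P D v - phi| + `|gd_G D v - G phi|) ->
  c <= gd_S D G phi.
Proof.
move=> cS; apply: lb_le_inf; last by move=> _ [v _ <-].
by exists (`|gd_P D 0 - phi| + `|gd_G D 0 - G phi|), 0.
Qed.

Lemma gd_S_ge0 : 0 <= gd_S D G phi.
Proof. by apply: le_gd_S => v; rewrite addr_ge0. Qed.

(** The form in which the infimum over interpolants is taken in the error
estimates: a bound valid for each [v] passes to [gd_S]. *)
Lemma le_affine_gd_S x y k : 0 < k ->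
  (forall v, x <= y + k * (`|gd_P D v - phi| + `|gd_G D v - G phi|)) ->
  x <= y + k * gd_S D G phi.
Proof.
move=> k0 xy; rewrite -lerBlDl -ler_pdivrMl//; apply: le_gd_S => v.
by rewrite ler_pdivrMl// lerBlDl.
Qed.

End consistency.

Section conformity.
Context (WG : set L) (G : L -> LL) (phi : dual LL).

Let defect v := phi (gd_G D v) + adjoint WG G phi (gd_P D v).

Let defect_scalar : scalar defect.
Proof.
move=> c u v; rewrite /defect !linearP/= /GRing.scale/= mulrDr.
by rewrite addrACA.
Qed.

Let defect_seminorm : is_seminorm (fun v => `|defect v|).
Proof.
pose h := HB.pack_for {linear D -> R^o} defect
  (GRing.isLinear.Build R D R^o _ defect defect_scalar).
exact: (is_seminorm_linear h).
Qed.

Lemma ler_gd_W v :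
  `|phi (gd_G D v) + adjoint WG G phi (gd_P D v)| <=
  gd_W D WG G phi * gd_norm v.
Proof. exact: ler_ratio_sup defect_seminorm gd_norm_is_norm v. Qed.

Lemma gd_W_ge0 : 0 <= gd_W D WG G phi.
Proof. exact: ratio_sup_ge0 defect_seminorm gd_norm_is_norm. Qed.

Lemma gd_W_le K : 0 <= K ->
  (forall v, `|phi (gd_G D v) + adjoint WG G phi (gd_P D v)| <=
             K * gd_norm v) ->
  gd_W D WG G phi <= K.
Proof.
move=> K0 phiK.
exact: (ratio_sup_le (p := fun v => `|defect v|) gd_norm_is_norm K0 phiK).
Qed.

End conformity.
End discretisation_constants.

(** * The gradient scheme and its error *)

Section gradient_scheme.
Context (R : realType) (alpha_up alpha_lo : R) (alpha_lo0 : 0 < alpha_lo).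
Context (L LL : normedModType R) (WG : set L) (G : L -> LL).
Context (WG_dense : dense WG) (V : set (dual L)).
Context (f : dual L) (F : dual LL).
Context (aa : {linear LL -> dual LL}) (a : {linear L -> dual L}).
Context (aa_cont : continuous aa) (aa_le : opnorm aa <= alpha_up).
Context (aa_coercive : forall v, alpha_lo * `|v| ^+ 2 <= aa v v).
Context (a_cont : continuous a) (a_le : opnorm a <= alpha_up).
Context (a_coercive : forall v, alpha_lo * dual_seminorm V v ^+ 2 <= a v v).
Context (D : gradient_discretisation LL V).

Let alpha_up0 : 0 <= alpha_up.
Proof. exact: le_trans (opnorm_ge0 aa) aa_le. Qed.

Definition gd_form (u v : D) : R :=
  aa (gd_G D u) (gd_G D v) + a (gd_P D u) (gd_P D v).

Lemma gd_form_scalarl v : scalar (gd_form^~ v).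
Proof.
move=> c x y.
by rewrite /gd_form (linearP (gd_G D)) (linearP (gd_P D)) !dual_applyP; ring.
Qed.

Lemma gd_form_scalarr u : scalar (gd_form u).
Proof.
by move=> c x y; rewrite /gd_form !linearP/= /GRing.scale/=; ring.
Qed.

Lemma gd_form_coercive u : alpha_lo * gd_norm u ^+ 2 <= gd_form u u.
Proof. by rewrite sqr_gd_norm mulrDr addrC lerD. Qed.

Definition gd_scheme (u : D) :=
  forall v : D, gd_form u v = f (gd_P D v) - F (gd_G D v).

(** Coercivity makes the form nondegenerate: if [gd_form u] vanishes, so does
[gd_norm u]. *)
Lemma gd_scheme_well_posed : exists! u : D, gd_scheme u.
Proof.
apply: (@nondegenerate_form_solvable _ _ gd_form
  (fun v => f (gd_P D v) - F (gd_G D v))).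
- exact: gd_form_scalarr.
- exact: gd_form_scalarl.
- by move=> c x y; rewrite !linearP/= /GRing.scale/=; ring.
move=> u u0; have [_ _ norm_eq0] := @gd_norm_is_norm _ _ _ _ D; apply: norm_eq0.
apply/eqP; rewrite -sqrf_eq0 eq_le sqr_ge0 andbT -(pmulr_rle0 _ alpha_lo0).
by rewrite -(u0 u) gd_form_coercive.
Qed.

Context (ub : L) (ub_sol : forall v, WG v ->
  aa (G ub) (G v) + a ub v = f v - F (G v)).

(** This is the equation satisfied by [ub], read as the definition of the adjoint
of [G]. *)
Lemma is_adjoint_flux : is_adjoint WG G (aa (G ub) + F) (a ub - f).
Proof.
move=> v /ub_sol sol; 
rewrite -[(aa (G ub) + F) (G v)]/(aa (G ub) (G v) + F (G v)).
rewrite -[(a ub - f) v]/(a ub v - f v).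
move: sol; lra.
Qed.

Lemma adjoint_flux : adjoint WG G (aa (G ub) + F) = a ub - f.
Proof.
apply: (is_adjoint_unique WG_dense _ is_adjoint_flux).
by apply: adjointP; exists (a ub - f); exact: is_adjoint_flux.
Qed.

Local Notation CD := (gd_C D).
Local Notation SD := (gd_S D G ub).
Local Notation WD := (gd_W D WG G (aa (G ub) + F)).

Context (uD : D) (uD_sol : gd_scheme uD).

Local Notation eG := `|G ub - gd_G D uD|.
Local Notation eP := `|ub - gd_P D uD|.

(** The conformity defect of the exact flux is the residual of the error: the
source terms [f] and [F] cancel between the two equations. *)
Lemma defect_error v :
  (aa (G ub) + F) (gd_G D v) + adjoint WG G (aa (G ub) + F) (gd_P D v) =
  aa (G ub - gd_G D uD) (gd_G D v) + a (ub - gd_P D uD) (gd_P D v).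
Proof.
rewrite adjoint_flux !dual_applyB.
rewrite -[(aa (G ub) + F) (gd_G D v)]/(aa (G ub) (gd_G D v) + F (gd_G D v)).
rewrite -[(a ub - f) (gd_P D v)]/(a ub (gd_P D v) - f (gd_P D v)).
by have := uD_sol v; rewrite /gd_form; lra.
Qed.

(** The key estimate, in which [v] is any candidate interpolant of [ub]. *)
Lemma gd_norm_error v :
  alpha_lo * gd_norm (v - uD) <=
  WD + alpha_up * (1 + CD) * (`|gd_P D v - ub| + `|gd_G D v - G ub|).
Proof.
set w := v - uD; set S := _ + `|_|.
have W0 := gd_W_ge0 D WG G (aa (G ub) + F).
have C0 := gd_C_ge0 D.
have S0 : 0 <= S by rewrite addr_ge0.
(* Coercivity yields the claim multiplied by [gd_norm w]. *)
have [w0|w0] := eqVneq (gd_norm w) 0.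
  by rewrite w0 mulr0 addr_ge0// !mulr_ge0// addr_ge0.
have {}w0 : 0 < gd_norm w by rewrite lt_neqAle eq_sym w0 gd_norm_ge0.
rewrite -(ler_pM2r w0) -[leLHS]mulrA -expr2.
apply: (le_trans (gd_form_coercive w)).
(* Insert the exact solution between [v] and [uD]. *)
have -> : gd_form w w = aa (gd_G D v - G ub) (gd_G D w)
    + a (gd_P D v - ub) (gd_P D w)
    + (aa (G ub - gd_G D uD) (gd_G D w) + a (ub - gd_P D uD) (gd_P D w)).
  by rewrite addrACA -!dual_applyD !subrKA -!linearB.
rewrite -defect_error mulrDl addrC lerD//.
  by apply: (le_trans (ler_norm _)); exact: ler_gd_W.
apply: le_trans (ler_norm _) _; apply: (le_trans (ler_normD _ _)).
have Pw := ler_gd_P w; have Gw := ler_gd_G w.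
apply: (@le_trans _ _ (alpha_up * `|gd_G D v - G ub| * ((1 + CD) * gd_norm w)
   + alpha_up * `|gd_P D v - ub| * ((1 + CD) * gd_norm w))).
  apply: lerD.
    apply: (le_trans (ler_continuous_form aa_cont aa_le _ _)).
    rewrite ler_wpM2l ?mulr_ge0// (le_trans Gw)//.
    by rewrite ler_peMl ?gd_norm_ge0// lerDl.
  apply: (le_trans (ler_continuous_form a_cont a_le _ _)).
  rewrite ler_wpM2l ?mulr_ge0// (le_trans Pw)//.
  by rewrite ler_wpM2r ?gd_norm_ge0// lerDr.
by rewrite le_eqVlt; apply/orP; left; apply/eqP; rewrite /S; ring.
Qed.

Lemma gradient_error_le :
  eG <= alpha_lo^-1 * (WD + (alpha_up * (1 + CD) + alpha_lo) * SD).
Proof.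
rewrite ler_pdivlMl//; apply: le_affine_gd_S => [|v].
  by rewrite ltr_wpDl// mulr_ge0// addr_ge0// gd_C_ge0.
set S := _ + `|_|.
have -> : G ub - gd_G D uD = (G ub - gd_G D v) + gd_G D (v - uD).
  by rewrite linearB subrKA.
have h : `|G ub - gd_G D v + gd_G D (v - uD)| <= S + gd_norm (v - uD).
  rewrite (le_trans (ler_normD _ _))// lerD ?ler_gd_G//.
  by rewrite distrC /S lerDr.
apply: (le_trans (ler_wpM2l (ltW alpha_lo0) h)); rewrite mulrDr.
by have := gd_norm_error v; rewrite -/S; lra.
Qed.

Lemma potential_error_le :
  eP <= alpha_lo^-1 *
    (CD * WD + (CD * (1 + CD) * alpha_up + alpha_lo) * SD).
Proof.
have C0 := gd_C_ge0 D.
rewrite ler_pdivlMl//; apply: le_affine_gd_S => [|v].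
  by rewrite ltr_wpDl// !mulr_ge0// addr_ge0.
set S := _ + `|_|.
have -> : ub - gd_P D uD = (ub - gd_P D v) + gd_P D (v - uD).
  by rewrite linearB subrKA.
have h : `|ub - gd_P D v + gd_P D (v - uD)| <= S + CD * gd_norm (v - uD).
  rewrite (le_trans (ler_normD _ _))// lerD ?ler_gd_P//.
  by rewrite distrC /S lerDl.
apply: (le_trans (ler_wpM2l (ltW alpha_lo0) h)); rewrite mulrDr.
have := ler_wpM2l C0 (gd_norm_error v); rewrite -/S.
move: (gd_norm _) (gd_W _ _ _ _) => N W; lra.
Qed.

(** The potential error enters with the factor [CD], since the norm of
[gd_P D v] is controlled by [CD * gd_norm v] only. *)
Lemma conformity_defect_le : WD <= alpha_up * (eG + CD * eP).
Proof.
have C0 := gd_C_ge0 D.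
apply: gd_W_le => [|v]; first by rewrite mulr_ge0// addr_ge0// mulr_ge0.
rewrite defect_error; apply: (le_trans (ler_normD _ _)).
rewrite mulrDr mulrDl lerD//.
  apply: (le_trans (ler_continuous_form aa_cont aa_le _ _)).
  by rewrite ler_wpM2l ?mulr_ge0// ler_gd_G.
apply: (le_trans (ler_continuous_form a_cont a_le _ _)).
rewrite [leRHS](_ : _ = alpha_up * eP * (CD * gd_norm v)); last by ring.
by rewrite ler_wpM2l ?mulr_ge0// ler_gd_P.
Qed.

Lemma conformity_defect_le_gradient :
  (forall u, a u = 0) -> WD <= alpha_up * eG.
Proof.
move=> a0; apply: gd_W_le => [|v]; first by rewrite mulr_ge0.
rewrite defect_error a0 addr0.
apply: (le_trans (ler_continuous_form aa_cont aa_le _ _)).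
by rewrite ler_wpM2l ?mulr_ge0// ler_gd_G.
Qed.

Lemma consistency_defect_le : SD <= eP + eG.
Proof. by rewrite [eP]distrC [eG]distrC; exact: gd_S_le. Qed.

(** [SD + WD] is at most [1 + alpha_up * (1 + CD)] times the error, and this factor
is at most [(1 + alpha_up) * (1 + CD)]. *)
Lemma error_lower_bound :
  (1 + `|alpha_up|)^-1 / (1 + CD) * (SD + WD) <= eP + eG.
Proof.
have C0 := gd_C_ge0 D.
have p0 := alpha_up0.
rewrite ger0_norm// -invfM ler_pdivrMl ?mulr_gt0 ?ltr_wpDr//.
have := conformity_defect_le; have := consistency_defect_le.
have : 0 <= CD * (eP + eG) by rewrite mulr_ge0// addr_ge0.
have : 0 <= alpha_up * eP by rewrite mulr_ge0.
have : 0 <= alpha_up * (CD * eG) by rewrite !mulr_ge0.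
lra.
Qed.

(** The factor of [WD] in the sum of the two error bounds is [1 + CD], and that of
[SD] is [alpha_up * (1 + CD) ^+ 2 + 2 * alpha_lo]. *)
Lemma error_upper_bound :
  eP + eG <=
  alpha_lo^-1 * (1 + `|alpha_up| + 2 * alpha_lo) * (1 + CD) ^+ 2 * (SD + WD).
Proof.
have C0 := gd_C_ge0 D.
have p0 := alpha_up0.
have W0 := gd_W_ge0 D WG G (aa (G ub) + F).
have S0 := gd_S_ge0 D G ub.
rewrite ger0_norm//.
apply: (le_trans (lerD potential_error_le gradient_error_le)).
rewrite -mulrDr -!mulrA ler_wpM2l ?invr_ge0 ?(ltW alpha_lo0)//.
move: (gd_C D) (gd_W _ _ _ _) (gd_S _ _ _) C0 W0 S0 => C W S C0 W0 S0.
have Cb : 1 + C <= (1 + C) ^+ 2 by rewrite expr2; nra.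
have h1 : (1 + C) * W <= (1 + C) ^+ 2 * W by rewrite ler_wpM2r.
have lo0 := ltW alpha_lo0.
have C1 : 0 <= 1 + C by rewrite addr_ge0.
have h2 : 2 * alpha_lo * S <= 2 * alpha_lo * ((1 + C) ^+ 2 * S).
  by rewrite ler_wpM2l ?mulr_ge0// ler_peMl//; lra.
have h3 : 0 <= alpha_up * ((1 + C) ^+ 2 * W) by rewrite !mulr_ge0.
have h4 : 0 <= alpha_lo * ((1 + C) ^+ 2 * W) by rewrite !mulr_ge0.
have h5 : 0 <= (1 + C) ^+ 2 * S by rewrite !mulr_ge0.
lra.
Qed.

End gradient_scheme.

Theorem theorem5p3 (R : realType) (alpha_up alpha_lo : R) (halpha : 0 < alpha_lo) :
  exists C1 C2 : R, [/\ 0 < C1, 0 < C2 &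
  forall (L LL : completeNormedModType R)
    (sepL : separable_space L) (sepLL : separable_space LL)
    (reflL : reflexive_space L) (reflLL : reflexive_space LL)
    (* the densely defined closed operator G : WG -> LL *)
    (WG : set L) (G : L -> LL)
    (WG_sub : submod_closed [in WG]) (WG_dense : dense WG)
    (G_linear : forall c u v, WG u -> WG v -> G (c *: u + v) = c *: G u + G v)
    (G_closed : closed [set z : L * LL | WG z.1 /\ z.2 = G z.1])
    (V : set (dual L))
    (V_sub : submod_closed [in V]) (V_closed : closed V)
    (V_norm : exists2 C : R, 0 < C & forall u, WG u ->
       Num.sqrt (`|u| ^+ 2 + `|G u| ^+ 2) <=
       C * Num.sqrt (dual_seminorm V u ^+ 2 + `|G u| ^+ 2))
    (f : dual L) (F : dual LL)
    (aa : {linear LL -> dual LL}) (a : {linear L -> dual L})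
    (H1 : continuous aa /\ opnorm aa <= alpha_up)
    (H2 : forall v, alpha_lo * `|v| ^+ 2 <= aa v v)
    (H3 : continuous a /\ opnorm a <= alpha_up)
    (H4 : forall v, alpha_lo * dual_seminorm V v ^+ 2 <= a v v)
    (ub : L) (WG_ub : WG ub)
    (ub_sol : forall v, WG v ->
       aa (G ub) (G v) + a ub v = f v - F (G v))
    (D : gradient_discretisation LL V),
  let scheme (uD : D) := forall v : D,
    aa (gd_G D uD) (gd_G D v) + a (gd_P D uD) (gd_P D v) = f (gd_P D v) - F (gd_G D v) in
  let CD := gd_C D in
  let SD := gd_S D G ub in
  let WD := gd_W D WG G (aa (G ub) + F) in
  [/\ dom_adjoint WG G (aa (G ub) + F),
      exists! uD : D, scheme uD
    & forall uD : D, scheme uD ->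
      let eG := `|G ub - gd_G D uD| in
      let eP := `|ub - gd_P D uD| in
      [/\ eG <= alpha_lo^-1 *
                 (WD + (alpha_up * (1 + CD) + alpha_lo) * SD)
          /\ eP <= alpha_lo^-1 *
                 (CD * WD + (CD * (1 + CD) * alpha_up + alpha_lo) * SD),
          (* The bound WD <= alpha_up * eG alone fails when a != 0: take
             L = LL = V = R, G = 0, a = aa = id, f = F = 1, PD = GD = id. *)
          WD <= alpha_up * (eG + CD * eP),
          (forall u, a u = 0) -> WD <= alpha_up * eG,
          SD <= eP + eG
        & C1 / (1 + CD) * (SD + WD) <= eP + eG
          /\ eP + eG <= C2 * (1 + CD) ^+ 2 * (SD + WD)]]].
Proof.
(* The constants come before the operators, whose norms force
   [0 <= alpha_up]; the absolute value makes them positive beforehand. *)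
exists (1 + `|alpha_up|)^-1, (alpha_lo^-1 * (1 + `|alpha_up| + 2 * alpha_lo)).
split.
- by rewrite invr_gt0 ltr_wpDr.
- by rewrite mulr_gt0 ?invr_gt0// addr_gt0 ?ltr_wpDr// mulr_gt0.
move=> L LL _ _ _ _ WG G _ WG_dense _ _ V _ _ _ f F aa a
  [aac aale] aaco [ac ale] aco ub _ ub_sol D scheme CD SD WD.
split; first by exists (a ub - f); exact: is_adjoint_flux.
- by have := gd_scheme_well_posed halpha f F aaco aco; apply.
move=> uD uD_sol eG eP; split.
- split.
    exact: (gradient_error_le halpha WG_dense aac aale aaco ac ale aco
            ub_sol uD_sol).
  exact: (potential_error_le halpha WG_dense aac aale aaco ac ale aco
            ub_sol uD_sol).
- exact: (conformity_defect_le WG_dense aac aale ac ale ub_sol uD_sol).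
- exact: (conformity_defect_le_gradient WG_dense aac aale ub_sol uD_sol).
- exact: consistency_defect_le.
- split; first exact: (error_lower_bound WG_dense aac aale ac ale ub_sol uD_sol).
  exact: (error_upper_bound halpha WG_dense aac aale aaco ac ale aco
            ub_sol uD_sol).
Qed.
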